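(* The super Jordan plane $\mathcal{B}$ over a field $\Bbbk$ of characteristic different from $2$ is a Noetherian algebra and has infinite global dimension.
   Context: Let $\Bbbk$ be a (commutative) field of characteristic $p \neq 2$ ($p=0$ is allowed). The super Jordan plane $\mathcal{B}$ is the associative unital $\Bbbk$-algebra presented by generators $x, y$ with defining relations $x^2 = 0$ and $yz - zy - xz = 0$, where $z = xy + yx$. *)

(* Defs.v *)
From HB Require Import structures.
From mathcomp Require Import all_boot all_order all_algebra.
From mathcomp Require Import generic_quotient ring_quotient.
From mathcomp Require Import boolp.
From mathcomp.multinomials Require Import monalg.

Set Implicit Arguments.
Unset Strict Implicit.
Unset Printing Implicit Defensive.

Import GRing.Theory.
Local Open Scope ring_scope.
Local Open Scope quotient_scope.

(* ring_quotient.v only equips quotients of commutative rings with a product. *)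

HB.mixin Record isProperTwoSided (R : nzRingType) (I : R -> bool) := {
  two_sided_proper : 1 \notin I;
  two_sidedMl : forall a u : R, u \in I -> a * u \in I;
  two_sidedMr : forall a u : R, u \in I -> u * a \in I
}.

#[short(type="twoSidedIdeal")]
HB.structure Definition TwoSidedIdeal (R : nzRingType) :=
  {I of GRing.ZmodClosed R I & isProperTwoSided R I}.

Section QuotientAlgebra.
Variables (K : nzRingType) (A : algType K) (I : twoSidedIdeal A).

Definition quot_alg : Type := Quotient.quot I.

HB.instance Definition _ := GRing.Zmodule.on quot_alg.
HB.instance Definition _ := EqQuotient.on quot_alg.

Definition quot_pi : A -> quot_alg := \pi.

Lemma quot_piP (a b : A) : reflect (quot_pi a = quot_pi b) (a - b \in I).
Proof. by rewrite Quotient.idealrBE; apply: eqP. Qed.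

Lemma quot_piW (P : quot_alg -> Prop) :
  (forall a, P (quot_pi a)) -> forall u, P u.
Proof. by move=> Ppi u; rewrite -[u]reprK; apply: Ppi. Qed.

Fact quot_pi_is_zmod_morphism : zmod_morphism quot_pi.
Proof. exact: pi_is_zmod_morphism. Qed.

HB.instance Definition _ :=
  GRing.isZmodMorphism.Build A quot_alg quot_pi quot_pi_is_zmod_morphism.

Definition quot_one : quot_alg := quot_pi 1.
Definition quot_mul (u v : quot_alg) : quot_alg := quot_pi (repr u * repr v).
Definition quot_scale (c : K) (u : quot_alg) : quot_alg := quot_pi (c *: repr u).

Let repr_piB (a : A) : repr (quot_pi a) - a \in I.
Proof. by apply/quot_piP; apply: reprK. Qed.

Lemma quot_piM (a b : A) : quot_mul (quot_pi a) (quot_pi b) = quot_pi (a * b).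
Proof.
apply/quot_piP; rewrite -(subrK (a * repr (quot_pi b)) (_ * repr _)).
rewrite -mulrBl -addrA -mulrBr; apply: rpredD.
  exact/two_sidedMr/repr_piB.
exact/two_sidedMl/repr_piB.
Qed.

Lemma quot_piZ (c : K) (a : A) : quot_scale c (quot_pi a) = quot_pi (c *: a).
Proof.
apply/quot_piP; rewrite -scalerBr -[X in c *: X]mul1r scalerAl.
exact/two_sidedMl/repr_piB.
Qed.

Fact quot_mulA : associative quot_mul.
Proof.
by elim/quot_piW=> a; elim/quot_piW=> b; elim/quot_piW=> c; rewrite !quot_piM mulrA.
Qed.

Fact quot_mul1q : left_id quot_one quot_mul.
Proof. by elim/quot_piW=> a; rewrite quot_piM mul1r. Qed.

Fact quot_mulq1 : right_id quot_one quot_mul.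
Proof. by elim/quot_piW=> a; rewrite quot_piM mulr1. Qed.

Fact quot_mulDl : left_distributive quot_mul +%R.
Proof.
elim/quot_piW=> a; elim/quot_piW=> b; elim/quot_piW=> c.
by rewrite -raddfD !quot_piM mulrDl raddfD.
Qed.

Fact quot_mulDr : right_distributive quot_mul +%R.
Proof.
elim/quot_piW=> a; elim/quot_piW=> b; elim/quot_piW=> c.
by rewrite -raddfD !quot_piM mulrDr raddfD.
Qed.

Fact quot_one_neq0 : quot_one != 0.
Proof.
rewrite -(raddf0 quot_pi); apply/eqP => /quot_piP; rewrite subr0.
exact/negP/two_sided_proper.
Qed.

HB.instance Definition _ := GRing.Zmodule_isNzRing.Build quot_alg
  quot_mulA quot_mul1q quot_mulq1 quot_mulDl quot_mulDr quot_one_neq0.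

Fact quot_scaleA (c d : K) (u : quot_alg) :
  quot_scale c (quot_scale d u) = quot_scale (c * d) u.
Proof. by elim/quot_piW: u => a; rewrite !quot_piZ scalerA. Qed.

Fact quot_scale1 : left_id 1 quot_scale.
Proof. by elim/quot_piW=> a; rewrite quot_piZ scale1r. Qed.

Fact quot_scaleDr : right_distributive quot_scale +%R.
Proof.
move=> c; elim/quot_piW=> a; elim/quot_piW=> b.
by rewrite -raddfD !quot_piZ scalerDr raddfD.
Qed.

Fact quot_scaleDl (u : quot_alg) :
  {morph quot_scale^~ u : c d / c + d >-> c + d}.
Proof.
by elim/quot_piW: u => a c d; rewrite !quot_piZ scalerDl raddfD.
Qed.

HB.instance Definition _ := GRing.Zmodule_isLmodule.Build K quot_alg
  quot_scaleA quot_scale1 quot_scaleDr quot_scaleDl.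

Fact quot_scaleAl (c : K) (u v : quot_alg) : c *: (u * v) = (c *: u) * v.
Proof.
elim/quot_piW: u => a; elim/quot_piW: v => b.
by rewrite /GRing.scale /GRing.mul /= quot_piM !quot_piZ quot_piM scalerAl.
Qed.

HB.instance Definition _ := GRing.Lmodule_isLalgebra.Build K quot_alg quot_scaleAl.

Fact quot_scaleAr (c : K) (u v : quot_alg) : c *: (u * v) = u * (c *: v).
Proof.
elim/quot_piW: u => a; elim/quot_piW: v => b.
by rewrite /GRing.scale /GRing.mul /= quot_piM !quot_piZ quot_piM scalerAr.
Qed.

HB.instance Definition _ := GRing.Lalgebra_isAlgebra.Build K quot_alg quot_scaleAr.

Fact quot_pi_is_monoid_morphism : monoid_morphism quot_pi.
Proof. by split=> // a b; rewrite -quot_piM. Qed.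

HB.instance Definition _ :=
  GRing.isMonoidMorphism.Build A quot_alg quot_pi quot_pi_is_monoid_morphism.

Fact quot_pi_is_scalable : scalable quot_pi.
Proof. by move=> c a; rewrite -quot_piZ. Qed.

HB.instance Definition _ :=
  GRing.isScalable.Build K A quot_alg *:%R quot_pi quot_pi_is_scalable.

End QuotientAlgebra.

Definition two_sided_closed (R : nzRingType) (I : {pred R}) : Prop :=
  [/\ zmod_closed I, forall a u, u \in I -> a * u \in I
    & forall a u, u \in I -> u * a \in I].

Definition ideal_gen (R : nzRingType) (s : seq R) : {pred R} :=
  fun a => `[< forall I : {pred R},
                 two_sided_closed I -> {subset s <= I} -> a \in I >].

Lemma ideal_gen_closed (R : nzRingType) (s : seq R) :
  two_sided_closed (ideal_gen s).
Proof.
split; first split.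
- by apply/asboolP => I [[]].
- move=> a b /asboolP ha /asboolP hb; apply/asboolP => I idI sI.
  by have [[_ IB] _ _] := idI; apply: IB; [apply: ha | apply: hb].
- move=> a u /asboolP hu; apply/asboolP => I idI sI.
  by have [_ IMl _] := idI; apply: IMl; apply: hu.
- move=> a u /asboolP hu; apply/asboolP => I idI sI.
  by have [_ _ IMr] := idI; apply: IMr; apply: hu.
Qed.

Lemma sub_ideal_gen (R : nzRingType) (s : seq R) : {subset s <= ideal_gen s}.
Proof. by move=> a sa; apply/asboolP => I _; apply. Qed.

Lemma ideal_gen_min (R : nzRingType) (s : seq R) (I : {pred R}) :
  two_sided_closed I -> {subset s <= I} -> {subset ideal_gen s <= I}.
Proof. by move=> idI sI a /asboolP; apply. Qed.

Lemma ideal_gen_proper (R S : nzRingType) (f : {rmorphism R -> S}) (s : seq R) :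
  {in s, forall a, f a = 0} -> 1 \notin ideal_gen s.
Proof.
move=> f0; apply/negP => /(@ideal_gen_min _ _ [pred a | f a == 0]).
rewrite inE rmorph1 oner_eq0 => H; apply/notF/H.
  split; first split; rewrite ?inE ?rmorph0 //.
  - by move=> a b; rewrite !inE rmorphB => /eqP-> /eqP->; rewrite subrr.
  - by move=> a u; rewrite !inE rmorphM => /eqP->; rewrite mulr0.
  - by move=> a u; rewrite !inE rmorphM => /eqP->; rewrite mul0r.
by move=> a /f0 fa0; rewrite inE fa0.
Qed.

(* Monoid algebra of the free monoid on 'I_n; monalg.v makes it an lalgType,
   and an algType only for commutative monoids. *)
Definition free_alg (K : comNzRingType) (n : nat) : Type :=
  {malg K[{fmonom 'I_n}]}.

HB.instance Definition _ (K : comNzRingType) (n : nat) :=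
  GRing.Lalgebra.on (free_alg K n).

Lemma malg_scalerAr (M : monomType) (R : comNzRingType) (c : R)
    (a b : {malg R[M]}) :
  c *: (a * b) = a * (c *: b).
Proof.
have cC (d : {malg R[M]}) : c%:MP * d = d * c%:MP.
  apply/malgP=> k; rewrite mcoeffCM.
  rewrite (mcoeffMrw _ (finmap.fsubset_refl _) (msuppC_le _)).
  rewrite finmap.big_seq_fset1 [in LHS](monalgE d) raddf_sum mulr_sumr.
  apply: eq_bigr => m _ /=.
  by rewrite mcoeffU eqxx mulr1n mulm1 mcoeffU mulrnAr mulrC.
by rewrite -!mul_malgC mulrA cC mulrA.
Qed.

HB.instance Definition _ (K : comNzRingType) (n : nat) :=
  GRing.Lalgebra_isAlgebra.Build K (free_alg K n)
    (@malg_scalerAr {fmonom 'I_n} K).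

Definition free_gen (K : comNzRingType) (n : nat) (i : 'I_n) : free_alg K n :=
  << fmu i >>.

Definition free_const_coeff (K : comNzRingType) (n : nat) : free_alg K n -> K :=
  mcoeff (mone : {fmonom 'I_n}).

HB.instance Definition _ (K : comNzRingType) (n : nat) :=
  GRing.RMorphism.copy (@free_const_coeff K n)
    (mcoeff (mone : {fmonom 'I_n}) : {malg K[{fmonom 'I_n}]} -> K).

Lemma free_const_coeff_gen (K : comNzRingType) (n : nat) (i : 'I_n) :
  free_const_coeff (free_gen K i) = 0.
Proof. by rewrite /free_const_coeff /free_gen mcoeffU1 fm1_eq1. Qed.

Section SuperJordanPlane.
Variable K : fieldType.

Definition sjp_relations : seq (free_alg K 2) :=
  let x := free_gen K (ord0 : 'I_2) in
  let y := free_gen K (ord_max : 'I_2) in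
  let z := x * y + y * x in
  [:: x ^+ 2; y * z - z * y - x * z].

Definition sjp_ideal : {pred free_alg K 2} := ideal_gen sjp_relations.

Fact sjp_ideal_zmod_closed : zmod_closed sjp_ideal.
Proof. by have [] := ideal_gen_closed sjp_relations. Qed.

HB.instance Definition _ :=
  GRing.isZmodClosed.Build (free_alg K 2) sjp_ideal sjp_ideal_zmod_closed.

Fact sjp_idealMl (a u : free_alg K 2) : u \in sjp_ideal -> a * u \in sjp_ideal.
Proof. by have [_ + _] := ideal_gen_closed sjp_relations; apply. Qed.

Fact sjp_idealMr (a u : free_alg K 2) : u \in sjp_ideal -> u * a \in sjp_ideal.
Proof. by have [_ _] := ideal_gen_closed sjp_relations; apply. Qed.

Fact sjp_ideal_proper : 1 \notin sjp_ideal.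
Proof.
apply: (@ideal_gen_proper _ _ (@free_const_coeff K 2)) => a.
have rel0 (R S : nzRingType) (f : {rmorphism R -> S}) (x y z : R) :
    f x = 0 -> f y = 0 -> f (y * z - z * y - x * z) = 0.
  by move=> x0 y0; rewrite !rmorphB !rmorphM x0 y0 !mul0r mulr0 !subrr.
rewrite !inE => /orP[] /eqP->.
  by rewrite rmorphXn /= free_const_coeff_gen expr0n.
by apply: rel0; apply: free_const_coeff_gen.
Qed.

HB.instance Definition _ := isProperTwoSided.Build (free_alg K 2) sjp_ideal
  sjp_ideal_proper sjp_idealMl sjp_idealMr.

Definition superJordan : Type := quot_alg sjp_ideal.

HB.instance Definition _ := GRing.Algebra.on superJordan.

Definition sjp_x : superJordan := quot_pi sjp_ideal (free_gen K ord0).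
Definition sjp_y : superJordan := quot_pi sjp_ideal (free_gen K ord_max).
Definition sjp_z : superJordan := sjp_x * sjp_y + sjp_y * sjp_x.

Lemma sjp_x2 : sjp_x ^+ 2 = 0.
Proof.
rewrite -(rmorph0 (quot_pi sjp_ideal)) -(rmorphXn (quot_pi sjp_ideal)).
by apply/quot_piP; rewrite subr0; apply/sub_ideal_gen; rewrite inE eqxx.
Qed.

Lemma sjp_yz : sjp_y * sjp_z - sjp_z * sjp_y - sjp_x * sjp_z = 0.
Proof.
rewrite /sjp_z /sjp_x /sjp_y -(rmorph0 (quot_pi sjp_ideal)).
rewrite -!(rmorphM (quot_pi sjp_ideal)) -(rmorphD (quot_pi sjp_ideal)).
rewrite -!(rmorphM (quot_pi sjp_ideal)) -!(rmorphB (quot_pi sjp_ideal)).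
apply/quot_piP; rewrite subr0; apply/sub_ideal_gen.
by rewrite !inE eqxx orbT.
Qed.

End SuperJordanPlane.

(* R^o is R as a left module over itself, so submod_closed singles out the left
   ideals.  Right modules and right ideals over R are left ones over the
   converse ring R^c. *)
Definition left_noetherian (R : pzRingType) : Prop :=
  forall I : nat -> {pred R^o},
    (forall n, submod_closed (I n)) ->
    (forall n, {subset I n <= I n.+1}) ->
    exists N, forall n, (N <= n)%N -> I n =i I N.

Definition noetherian (R : pzRingType) : Prop :=
  left_noetherian R /\ left_noetherian R^c.

Definition projective (R : pzRingType) (P : lmodType R) : Prop :=
  forall (M N : lmodType R) (f : {linear M -> N}) (g : {linear P -> N}),
    (forall y : N, exists x : M, f x = y) ->
    exists h : {linear P -> M}, forall p, f (h p) = g p.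

(* M has a projective resolution 0 -> P n -> ... -> P 0 -> M -> 0. *)
Definition pdim_le (R : pzRingType) (n : nat) (M : lmodType R) : Prop :=
  exists (P : nat -> lmodType R) (d : forall i, {linear P i.+1 -> P i})
         (e : {linear P 0%N -> M}),
    [/\ forall i, projective (P i),
        forall i, (n < i)%N -> forall u : P i, u = 0,
        forall m : M, exists u, e u = m,
        forall u, e u = 0 <-> exists v, d 0%N v = u
      & forall i u, d i u = 0 <-> exists v, d i.+1 v = u].

Definition left_gldim_le (R : pzRingType) (n : nat) : Prop :=
  forall M : lmodType R, pdim_le n M.

Definition infinite_left_gldim (R : pzRingType) : Prop :=
  forall n, ~ left_gldim_le R n.

(* The left and right global dimensions agree for Noetherian rings; both are
   required to be infinite. *)
Definition infinite_gldim (R : pzRingType) : Prop :=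
  infinite_left_gldim R /\ infinite_left_gldim R^c.

(* Main.v *)
From HB Require Import structures.
Require Import Defs.
From mathcomp Require Import all_boot all_order all_algebra.
From mathcomp Require Import generic_quotient finmap boolp.
From mathcomp.multinomials Require Import monalg.

(** Write B for the super Jordan plane and z = xy + yx.  The relations give
    zx = xz, yx = -xy + z and yz = zy + xz, so that B is built from K in three
    steps of Ore type, K, K[x], K[x, z], B: in each of them a generator t is
    added to a subring A with At + A = tA + A.

    Noetherianity.  Hilbert's basis theorem holds for each such step
    ([ore_ext_noetherian]).  The field K is Noetherian, hence so is B on the
    left.  The map x |-> -x, y |-> y extends to an anti-automorphism of B
    ([sjp_anti_involution]), which transports the result to the right.

    Infinite global dimension.  Multiplication by x squares to zero on every
    B-module M, so the homology ker x / im x is defined.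
    - It vanishes for M = B ([sjp_mulx_exact]).  This is where the size of B
      matters: B acts on the K-space of pairs (f, g) of polynomials in y and z
      as left multiplication would act on the normally ordered elements f + xg,
      namely by x(f, g) = (0, f) and y(f, g) = (yf + zg, z df/dz - yg).  The
      evaluation (f, g) |-> f + xg is B-linear, so every b in B is the
      evaluation of b(1, 0); and xb = 0 forces the first component of b(1, 0)
      to vanish, hence b lies in xB.
    - It therefore vanishes for free modules and their retracts, the projective
      modules ([projective_mult_exact]).
    - By dimension shifting it vanishes for all modules of finite projective
      dimension ([infinite_left_gldim_of_exact]).
    - It does not vanish for the one-dimensional module on which x and y act
      by zero.
    The right-hand version follows through the anti-automorphism again. *)

Set Implicit Arguments.
Unset Strict Implicit.
Unset Printing Implicit Defensive.

Import GRing.Theory.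
Local Open Scope ring_scope.

(** * Square-zero elements and projective dimension *)

(** For x of square zero this is the vanishing of the homology of M with
    respect to multiplication by x. *)
Definition mult_exact (R : nzRingType) (x : R) (M : lmodType R) : Prop :=
  forall m : M, x *: m = 0 -> exists m', m = x *: m'.

Lemma retract_mult_exact (R : nzRingType) (x : R) (M P : lmodType R)
    (f : {linear M -> P}) (h : {linear P -> M}) :
  cancel h f -> mult_exact x M -> mult_exact x P.
Proof.
move=> hK exM p xp0; case: (exM (h p)); first by rewrite -linearZ xp0 linear0.
by move=> m hpE; exists (f m); rewrite -linearZ -hpE hK.
Qed.

Lemma free_mult_exact (R : nzRingType) (x : R) (I : choiceType) :
  (forall b : R, x * b = 0 -> exists c, b = x * c) ->
  mult_exact x {malg R[I]}.
Proof.
move=> exR g xg0.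
have /boolp.choice[c cE] (k : I) : exists c, g@_k = x * c.
  by apply: exR; rewrite -mcoeffZ xg0 mcoeff0.
exists [malg k in msupp g => c k]; apply/malgP=> k.
rewrite mcoeffZ mcoeffE; case: ifPn => // kg.
by rewrite mulr0 mcoeff_outdom.
Qed.

Section FreeCover.
Variables (R : nzRingType) (M : lmodType R).

Definition malg_eval (g : {malg R[M]}) : M := \sum_(m <- msupp g) g@_m *: m.

Lemma malg_evalEw (d : {fset M}) (g : {malg R[M]}) : (msupp g `<=` d)%fset ->
  malg_eval g = \sum_(m <- d) g@_m *: m.
Proof.
move=> le; rewrite [LHS](big_fset_incl _ le) // => m _ /mcoeff_outdom ->.
by rewrite scale0r.
Qed.

Fact malg_eval_linear : linear malg_eval.
Proof.
move=> c g1 g2.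
pose d := (msupp g1 `|` msupp g2)%fset.
have sub1 : (msupp g1 `<=` d)%fset by apply: fsubsetUl.
have sub2 : (msupp g2 `<=` d)%fset by apply: fsubsetUr.
have sub3 : (msupp (c *: g1 + g2) `<=` d)%fset.
  apply: fsubset_trans (msuppD_le _ _) _; rewrite fsubUset sub2 andbT.
  exact: fsubset_trans (msuppZ_le _ _) sub1.
rewrite !(malg_evalEw sub1, malg_evalEw sub2, malg_evalEw sub3).
rewrite scaler_sumr -big_split /=; apply: eq_bigr => m _.
by rewrite mcoeffD mcoeffZ scalerDl scalerA.
Qed.

HB.instance Definition _ :=
  GRing.isLinear.Build R {malg R[M]} M *:%R malg_eval malg_eval_linear.

Lemma malg_evalU m : malg_eval << m >> = m.
Proof.
by rewrite /malg_eval msuppU oner_eq0 big_seq_fset1 mcoeffUU scale1r.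
Qed.
End FreeCover.

(** A projective module is a retract of the free module on its own elements. *)
Lemma projective_mult_exact (R : nzRingType) (x : R) (P : lmodType R) :
  (forall b : R, x * b = 0 -> exists c, b = x * c) ->
  projective P -> mult_exact x P.
Proof.
move=> exR projP.
have [p|h hK] := projP _ _ (@malg_eval R P : {linear {malg R[P]} -> P})
  (idfun : {linear P -> P}).
  by exists << p >>; apply: malg_evalU.
apply: (@retract_mult_exact _ _ {malg R[P]} _ (@malg_eval R P) h) => //.
exact: free_mult_exact.
Qed.

(** Since projective modules have no x-homology, the x-homology of a module is
    that of each of its syzygies in turn, and the last syzygy of a finite
    resolution is zero.  The chase below does this with elements: an x-cycle m
    is lifted to u with xu in the image of the differential, and descending
    induction on the degree (the claim [shift]) turns such a u into an
    x-boundary up to the image of the differential. *)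
Lemma infinite_left_gldim_of_exact (R : nzRingType) (x : R) (M : lmodType R)
    (m : M) :
    x * x = 0 -> (forall b : R, x * b = 0 -> exists c, b = x * c) ->
    x *: m = 0 -> (forall m' : M, m <> x *: m') ->
  infinite_left_gldim R.
Proof.
move=> xx0 exR xm0 mNx n /(_ M)[P [d [e [projP P0 e_surj ker_e ker_d]]]].
have exP i : mult_exact x (P i) by apply: projective_mult_exact.
have shift j : forall i (u : P i) w, (n < i + j)%N -> x *: u = d i w ->
    exists v w', u = x *: v + d i w'.
  elim: j => [|j IHj] i u w.
    rewrite addn0 => /P0 u0 _; exists 0, 0.
    by rewrite (u0 u) linear0 scaler0 addr0.
  rewrite addnS -addSn => lt_n xu.
  have /ker_d[t tE] : d i (x *: w) = 0.
    by rewrite linearZ -xu /= scalerA xx0 scale0r.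
  have [v [w' wE]] := IHj _ _ _ lt_n (esym tE).
  have /exP[v' v'E] : x *: (u - d i v) = 0.
    rewrite scalerBr xu wE linearD linearZ /=.
    suff /ker_d -> : exists t', d i.+1 t' = d i.+1 w' by rewrite addr0 subrr.
    by exists w'.
  by exists v', v; rewrite -v'E subrK.
have [u uE] := e_surj m.
have /ker_e[w wE] : e (x *: u) = 0 by rewrite linearZ uE.
have [//|v [w' uvE]] := shift n.+1 0%N u w _ (esym wE).
apply: (mNx (e v)); rewrite -uE uvE linearD linearZ /=.
suff /ker_e -> : exists t, d 0%N t = d 0%N w' by rewrite addr0.
by exists w'.
Qed.

(** * Modules given by an explicit action *)

Record ring_action (R : nzRingType) (V : zmodType) (act : R -> V -> V) : Prop :=
  RingAction {
    action1 : forall v, act 1 v = v;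
    actionM : forall a b v, act (a * b) v = act a (act b v);
    actionDl : forall a b v, act (a + b) v = act a v + act b v;
    actionDr : forall a u v, act a (u + v) = act a u + act a v
  }.

Section ActionTheory.
Variables (R : nzRingType) (V : zmodType) (act : R -> V -> V).
Hypothesis actP : ring_action act.

Lemma action0r a : act a 0 = 0.
Proof. by apply: (addrI (act a 0)); rewrite -(actionDr actP) !addr0. Qed.

Lemma action0l v : act 0 v = 0.
Proof. by apply: (addrI (act 0 v)); rewrite -(actionDl actP) !addr0. Qed.

Lemma actionNl a v : act (- a) v = - act a v.
Proof. by apply: (addrI (act a v)); rewrite -(actionDl actP) !subrr action0l. Qed.

Lemma action_sjp_relation (x y : R) (X Y : V -> V) v :
  act x =1 X -> act y =1 Y ->
  let z := x * y + y * x in let Z u := X (Y u) + Y (X u) in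
  act (y * z - z * y - x * z) v = Y (Z v) - Z (Y v) - X (Z v).
Proof.
move=> actx acty; rewrite /= !(actionDl actP, actionNl, actionM actP).
by rewrite !(actionDl actP, actionM actP, actx, acty).
Qed.

Definition action_module of ring_action act : Type := V.

HB.instance Definition _ := GRing.Zmodule.on (action_module actP).
HB.instance Definition _ := GRing.Zmodule_isLmodule.Build R (action_module actP)
  (fun a b v => esym (actionM actP a b v)) (action1 actP) (actionDr actP)
  (fun v a b => actionDl actP a b v).
End ActionTheory.

Lemma infinite_left_gldim_of_action (R : nzRingType) (x : R) (V : zmodType)
    (act : R -> V -> V) (v : V) :
    x * x = 0 -> (forall b : R, x * b = 0 -> exists c, b = x * c) ->
    ring_action act -> (forall u, act x u = 0) -> v <> 0 ->
  infinite_left_gldim R.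
Proof.
move=> xx exR actP act0 v0.
apply: (@infinite_left_gldim_of_exact R x (action_module actP) v) => // u.
by rewrite [_ *: _]act0.
Qed.

(** * Hilbert's basis theorem for extensions of Ore type *)

Record subring (R : nzRingType) (A : R -> Prop) : Prop := Subring {
  subring1 : A 1;
  subringB : forall a b, A a -> A b -> A (a - b);
  subringM : forall a b, A a -> A b -> A (a * b)
}.

Section SubringTheory.
Variables (R : nzRingType) (A : R -> Prop).
Hypothesis ringA : subring A.

Lemma subring0 : A 0.
Proof. by rewrite -(subrr 1); apply: (subringB ringA); apply: subring1. Qed.

Lemma subringN a : A a -> A (- a).
Proof. by rewrite -sub0r; apply: (subringB ringA); apply: subring0. Qed.

Lemma subringD a b : A a -> A b -> A (a + b).
Proof. by move=> Aa /subringN; rewrite -{2}(opprK b); apply: subringB. Qed.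

Lemma subringX a n : A a -> A (a ^+ n).
Proof.
move=> Aa; elim: n => [|n IHn]; first exact: subring1.
by rewrite exprS; apply: subringM.
Qed.
End SubringTheory.

Record left_submod (R : nzRingType) (A I : R -> Prop) : Prop := LeftSubmod {
  left_submod0 : I 0;
  left_submodB : forall u v, I u -> I v -> I (u - v);
  left_submodM : forall a u, A a -> I u -> I (a * u)
}.

Definition noetherian_subring (R : nzRingType) (A : R -> Prop) : Prop :=
  forall I : nat -> R -> Prop,
    (forall n, left_submod A (I n)) ->
    (forall n u, I n u -> A u) ->
    (forall n u, I n u -> I n.+1 u) ->
    exists N, forall n, (N <= n)%N -> forall u, I n u -> I N u.

Lemma chain_homo (T : Type) (I : nat -> T -> Prop) :
  (forall n u, I n u -> I n.+1 u) ->
  forall m n, (m <= n)%N -> forall u, I m u -> I n u.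
Proof.
move=> Ihomo m n /subnK <-; elim: (n - m)%N => [|k IHk] u Imu //.
by apply: Ihomo; apply: IHk.
Qed.

Lemma division_noetherian (R : nzRingType) (A : R -> Prop) :
  (forall a, A a -> a <> 0 -> exists2 b, A b & b * a = 1) ->
  noetherian_subring A.
Proof.
move=> divA I subI IA Ihomo.
have [[N [u [Iu u0]]]|noI] := pselect (exists n u, I n u /\ u <> 0).
  exists N => n _ v /IA Av; have [b Ab bu1] := divA u (IA _ _ Iu) u0.
  rewrite -(mulr1 v) -bu1.
  exact: (left_submodM (subI N) Av (left_submodM (subI N) Ab Iu)).
exists 0%N => n _ v Iv; have [->|/eqP v0] := eqVneq v 0.
  exact: (left_submod0 (subI _)).
by case: noI; exists n, v.
Qed.

(** In an Ore extension, where ta = s(a)t + d(a), the second condition says that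
    a is in the image of the twist s and the third that s and d map a into A.
    Having both lets coefficients be moved across powers of t in either
    direction. *)
Definition ore_compatible (R : nzRingType) (A : R -> Prop) (t a : R) : Prop :=
  [/\ A a, exists2 a', A a' & A (a * t - t * a')
    & exists2 a', A a' & A (a' * t - t * a)].

(** It is enough to check compatibility on generators of A. *)
Lemma ore_compatible_subring (R : nzRingType) (A : R -> Prop) (t : R) :
  subring A -> subring (ore_compatible A t).
Proof.
move=> ringA; split.
- split; first exact: subring1.
    by exists 1; [exact: subring1 | rewrite mul1r mulr1 subrr; exact: subring0].
  by exists 1; [exact: subring1 | rewrite mul1r mulr1 subrr; exact: subring0].
- move=> a b [Aa [a1 Aa1 Aat] [a2 Aa2 Ata]] [Ab [b1 Ab1 Abt] [b2 Ab2 Atb]].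
  split; first exact: subringB.
    exists (a1 - b1); first exact: subringB.
    rewrite mulrBl mulrBr.
    rewrite [X in A X](_ : _ = (a * t - t * a1) - (b * t - t * b1)).
      exact: subringB.
    by rewrite !opprD !opprK addrACA.
  exists (a2 - b2); first exact: subringB.
  rewrite mulrBl mulrBr.
  rewrite [X in A X](_ : _ = (a2 * t - t * a) - (b2 * t - t * b)).
    exact: subringB.
  by rewrite !opprD !opprK addrACA.
move=> a b [Aa [a1 Aa1 Aat] [a2 Aa2 Ata]] [Ab [b1 Ab1 Abt] [b2 Ab2 Atb]].
split; first exact: subringM.
  exists (a1 * b1); first exact: subringM.
  rewrite [X in A X](_ : _ = a * (b * t - t * b1) + (a * t - t * a1) * b1).
    by apply: subringD => //; apply: subringM.
  by rewrite mulrBr mulrBl !mulrA addrA subrK.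
exists (a2 * b2); first exact: subringM.
rewrite [X in A X](_ : _ = a2 * (b2 * t - t * b) + (a2 * t - t * a) * b).
  by apply: subringD => //; apply: subringM.
by rewrite mulrBr mulrBl !mulrA addrA subrK.
Qed.

Lemma ore_compatible_comm (R : nzRingType) (A : R -> Prop) (t a : R) :
  subring A -> A a -> a * t = t * a -> ore_compatible A t a.
Proof.
move=> ringA Aa at_ta.
by split=> //; exists a; rewrite // at_ta subrr; apply: subring0.
Qed.

Section OreExtension.
Variables (R : nzRingType) (A : R -> Prop) (t : R).
Hypothesis ringA : subring A.

Let A0 : A 0 := subring0 ringA.

(** The recursion peels off a top term, whose coefficient need not be unique.
    Coefficients stand on the right of the powers of t: the leading coefficients
    of a left ideal then form a left ideal that grows with the degree, without
    any twist. *)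
Fixpoint deg_lt (n : nat) (r : R) : Prop :=
  if n is m.+1 then exists2 a, A a & deg_lt m (r - t ^+ m * a) else r = 0.

Definition ore_ext (r : R) : Prop := exists n, deg_lt n r.

Lemma deg_lt0 n : deg_lt n 0.
Proof. by elim: n => //= n IHn; exists 0; rewrite ?mulr0 ?subr0. Qed.

Lemma deg_ltB n r s : deg_lt n r -> deg_lt n s -> deg_lt n (r - s).
Proof.
elim: n r s => [|n IHn] r s /=; first by move=> -> ->; rewrite subrr.
move=> [a Aa ra] [b Ab sb]; exists (a - b); first exact: subringB.
rewrite mulrBr [X in deg_lt _ X](_ : _ = (r - t ^+ n * a) - (s - t ^+ n * b)).
  exact: IHn.
by rewrite !opprD !opprK addrACA.
Qed.

Lemma deg_ltD n r s : deg_lt n r -> deg_lt n s -> deg_lt n (r + s).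
Proof.
move=> rn sn; rewrite -[s]opprK -[- s]sub0r; apply: deg_ltB => //.
by apply: deg_ltB => //; apply: deg_lt0.
Qed.

Lemma deg_ltS n r : deg_lt n r -> deg_lt n.+1 r.
Proof. by exists 0; rewrite ?mulr0 ?subr0. Qed.

Lemma deg_ltW m n r : (m <= n)%N -> deg_lt m r -> deg_lt n r.
Proof. by move=> le_mn; apply: chain_homo le_mn _; apply: deg_ltS. Qed.

Lemma deg_lt_lead n a r : A a -> deg_lt n r -> deg_lt n.+1 (t ^+ n * a + r).
Proof. by exists a; rewrite // addrC addKr. Qed.

Lemma deg_ltS_lead n r :
  deg_lt n.+1 r -> exists2 a, A a & exists2 s, deg_lt n s & r = t ^+ n * a + s.
Proof.
move=> [a Aa ra]; exists a => //.
by exists (r - t ^+ n * a); rewrite // addrC subrK.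
Qed.

Lemma deg_ltMr n r a : deg_lt n r -> A a -> deg_lt n (r * a).
Proof.
elim: n r => [|n IHn] r /=; first by move=> ->; rewrite mul0r.
move=> [b Ab rb] Aa; exists (b * a); first exact: subringM.
by rewrite mulrA -mulrBl; apply: IHn.
Qed.

Lemma deg_lt_mulX n r : deg_lt n r -> deg_lt n.+1 (t * r).
Proof.
elim: n r => [|n IHn] r; first by move=> ->; rewrite mulr0; apply: deg_lt0.
move=> [a Aa ra]; exists a => //.
by rewrite exprS -mulrA -mulrBr; apply: IHn.
Qed.

Lemma ore_ext_base a : A a -> ore_ext a.
Proof. by move=> Aa; exists 1%N, a; rewrite // mul1r subrr. Qed.

Lemma ore_ext_gen : ore_ext t.
Proof.
exists 2; exists 1; first exact: subring1.
by rewrite mulr1 subrr; apply: deg_lt0.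
Qed.

Hypothesis compatA : forall a, A a -> ore_compatible A t a.

Lemma pull_rightX n a : A a ->
  exists2 a', A a' & deg_lt n (a * t ^+ n - t ^+ n * a').
Proof.
elim: n a => [|n IHn] a Aa; first by exists a => //=; rewrite mulr1 mul1r subrr.
have [_ [b Ab Ac] _] := compatA Aa; set c := _ - _ in Ac.
have [b' Ab' sn] := IHn b Ab; have [c' Ac' s'n] := IHn c Ac.
exists b' => //; rewrite [X in deg_lt _ X](_ : _ =
  t * (b * t ^+ n - t ^+ n * b') + (t ^+ n * c' + (c * t ^+ n - t ^+ n * c'))).
  apply: deg_ltD; first exact: deg_lt_mulX.
  exact: deg_lt_lead.
rewrite [t ^+ n * c' + _]addrC subrK mulrBr mulrBl [RHS]addrC addrA.
by rewrite exprS !mulrA subrK.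
Qed.

Lemma pull_leftX n a : A a ->
  exists2 a', A a' & deg_lt n (a' * t ^+ n - t ^+ n * a).
Proof.
elim: n a => [|n IHn] a Aa; first by exists a => //=; rewrite mulr1 mul1r subrr.
have [b Ab bn] := IHn a Aa.
have [_ _ [a' Aa' Ac]] := compatA Ab; set c := _ - _ in Ac.
have [c' Ac' cn] := pull_rightX n Ac.
exists a' => //; rewrite [X in deg_lt _ X](_ : _ =
  t * (b * t ^+ n - t ^+ n * a) + (t ^+ n * c' + (c * t ^+ n - t ^+ n * c'))).
  apply: deg_ltD; first exact: deg_lt_mulX.
  exact: deg_lt_lead.
rewrite [t ^+ n * c' + _]addrC subrK mulrBr mulrBl [RHS]addrC addrA.
by rewrite exprS !mulrA subrK.
Qed.

Lemma deg_ltMl n r a : A a -> deg_lt n r -> deg_lt n (a * r).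
Proof.
move=> Aa; elim: n r => [|n IHn] r; first by move=> ->; rewrite mulr0.
move=> /deg_ltS_lead[b Ab [s sn ->]]; have [a' Aa' qn] := pull_rightX n Aa.
rewrite mulrDr mulrA -(subrK (t ^+ n * a') (a * t ^+ n)) mulrDl -mulrA.
rewrite addrAC addrC; apply: deg_lt_lead; first exact: subringM.
by apply: deg_ltD; [apply: deg_ltMr | apply: IHn].
Qed.

Lemma ore_extM r s : ore_ext r -> ore_ext s -> ore_ext (r * s).
Proof.
move=> [m]; elim: m r s => [|m IHm] r s.
  by move=> -> _; exists 0%N; rewrite mul0r.
move=> /deg_ltS_lead[a Aa [q qm ->]] ext_s; have [n qsn] := IHm q s qm ext_s.
have [k ask] : ore_ext (t ^+ m * (a * s)).
  case: ext_s => k /(deg_ltMl Aa).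
  elim: m (a * s) {IHm qm} => [|m IHm] u uk; first by exists k; rewrite mul1r.
  by rewrite exprS -mulrA; have [l ul] := IHm u uk; exists l.+1; apply: deg_lt_mulX.
exists (maxn k n); rewrite mulrDl -mulrA; apply: deg_ltD.
  exact: deg_ltW (leq_maxl _ _) ask.
exact: deg_ltW (leq_maxr _ _) qsn.
Qed.

Lemma ore_ext_subring : subring ore_ext.
Proof.
split; last exact: ore_extM.
  by apply: ore_ext_base; apply: subring1.
move=> r s [m rm] [n sn]; exists (maxn m n); apply: deg_ltB.
  exact: deg_ltW (leq_maxl _ _) rm.
exact: deg_ltW (leq_maxr _ _) sn.
Qed.

Definition lead (I : R -> Prop) (n : nat) (a : R) : Prop :=
  A a /\ exists2 r, deg_lt n r & I (t ^+ n * a + r).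

(** If t ^+ n * a + r is in I and b in A, then b * a is again a leading
    coefficient of degree n: multiply on the left by the b' for which
    b' * t ^+ n and t ^+ n * b agree in degree n. *)
Lemma lead_submod I n : left_submod ore_ext I -> left_submod A (lead I n).
Proof.
move=> subI; split.
- split=> //; exists 0; rewrite ?mulr0 ?addr0; first exact: deg_lt0.
  exact: (left_submod0 subI).
- move=> a b [Aa [r rn Ir]] [Ab [s sn Is]]; split; first exact: subringB.
  exists (r - s); first exact: deg_ltB.
  rewrite mulrBr addrACA -opprD; exact: (left_submodB subI).
move=> b a Ab [Aa [r rn Ir]]; split; first exact: subringM.
have [b' Ab' qn] := pull_leftX n Ab.
exists ((b' * t ^+ n - t ^+ n * b) * a + b' * r).
  by apply: deg_ltD; [apply: deg_ltMr | apply: deg_ltMl].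
rewrite addrA mulrA -mulrDl [_ + (_ - _)]addrC subrK -mulrA -mulrDr.
by apply: (left_submodM subI) => //; apply: ore_ext_base.
Qed.

Lemma lead_homo_deg I n a :
  left_submod ore_ext I -> lead I n a -> lead I n.+1 a.
Proof.
move=> subI [Aa [r rn Ir]]; split=> //.
exists (t * r); first exact: deg_lt_mulX.
rewrite exprS -mulrA -mulrDr; apply: (left_submodM subI) => //.
exact: ore_ext_gen.
Qed.

(** Nested left ideals with the same leading coefficients coincide: subtract
    an element of I with the same leading term and induct on the degree. *)
Lemma lead_reflects_sub I J :
    left_submod ore_ext I -> left_submod ore_ext J ->
    (forall u, I u -> J u) -> (forall u, J u -> ore_ext u) ->
    (forall n a, lead J n a -> lead I n a) ->
  forall u, J u -> I u.
Proof.
move=> subI subJ IJ Jext leadJI u Ju; have [n un] := Jext u Ju.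
elim: n u un Ju => [|n IHn] u; first by move=> -> _; apply: (left_submod0 subI).
move=> /deg_ltS_lead[a Aa [r rn uE]] Ju.
have [_ [s sn Is]] : lead I n a.
  by apply: leadJI; split=> //; exists r; rewrite -?uE.
have Ius : I (u - (t ^+ n * a + s)).
  apply: IHn; last by apply: (left_submodB subJ) => //; apply: IJ.
  by rewrite uE opprD addrACA subrr add0r; apply: deg_ltB.
rewrite -(subrK (t ^+ n * a + s) u) -[X in I (_ + X)]opprK.
apply: (left_submodB subI) => //.
by rewrite -sub0r; apply: (left_submodB subI (left_submod0 subI)).
Qed.

(** The modules of leading coefficients lead (I k) n grow both with k and with
    n.  The diagonal lead (I n) n is stationary from some N on, which settles
    all degrees n >= N at once; the finitely many chains in k with n < N settle
    the others. *)
Lemma ore_ext_noetherian : noetherian_subring A -> noetherian_subring ore_ext.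
Proof.
move=> noethA I subI Iext Ihomo.
have lead_chain k l n a : (k <= l)%N -> lead (I k) n a -> lead (I l) n a.
  move=> le_kl [Aa [r rn Ir]]; split=> //; exists r => //.
  exact: (chain_homo Ihomo le_kl).
have lead_deg k m n a : (m <= n)%N -> lead (I k) m a -> lead (I k) n a.
  move=> le_mn; apply: chain_homo le_mn _ => {}n {}a; exact: lead_homo_deg.
have [N diagN] : exists N, forall n, (N <= n)%N ->
    forall a, lead (I n) n a -> lead (I N) N a.
  apply: (noethA (fun n => lead (I n) n)) => [n|n a []|n a /lead_homo_deg] //.
    exact: lead_submod.
  by move=> /(_ (subI n)); apply: lead_chain.
have [M colM] : exists M, forall k n a, (n < N)%N -> (M <= k)%N ->
    lead (I k) n a -> lead (I M) n a.
  elim: (N) => [|m [M colM]]; first by exists 0%N.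
  have [M' colM'] : exists M', forall k, (M' <= k)%N ->
      forall a, lead (I k) m a -> lead (I M') m a.
    apply: (noethA (fun k => lead (I k) m)) => [k|k a []|k a] //.
      exact: lead_submod.
    exact: lead_chain.
  exists (maxn M M') => k n a; rewrite ltnS leq_eqVlt geq_max.
  case/orP=> [/eqP->|lt_nm] /andP[le_Mk le_M'k].
    by move/(colM' _ le_M'k); apply: lead_chain; apply: leq_maxr.
  by move/(colM _ _ _ lt_nm le_Mk); apply: lead_chain; apply: leq_maxl.
exists (maxn N M) => k le_k.
have [le_Nk le_Mk] : (N <= k)%N /\ (M <= k)%N.
  by apply/andP; rewrite -geq_max.
apply: lead_reflects_sub => //; [exact: chain_homo | exact: Iext |].
move=> n a; case: (ltnP n N) => [lt_nN|le_Nn].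
  move/(colM _ _ _ lt_nN le_Mk); apply: lead_chain; exact: leq_maxr.
move=> lead_a; have leadN : lead (I N) N a.
  apply: (diagN (maxn k n)); first by rewrite leq_max le_Nk.
  apply: lead_deg (leq_maxr k n) _.
  exact: lead_chain (leq_maxl k n) lead_a.
by apply: lead_deg le_Nn _; apply: lead_chain (leq_maxl _ _) leadN.
Qed.

End OreExtension.

Lemma ore_ext_ind (R : nzRingType) (A P : R -> Prop) (t : R) :
  subring P -> (forall a, A a -> P a) -> P t -> forall r, ore_ext A t r -> P r.
Proof.
move=> ringP AP Pt r [n]; elim: n r => [|n IHn] r.
  by move=> ->; apply: subring0.
move=> [a /AP Pa /IHn Pr]; rewrite -[r](subrK (t ^+ n * a)).
apply: (subringD ringP) => //; apply: (subringM ringP) => //.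
exact: subringX.
Qed.

(** * Modules over the super Jordan plane from generators and relations *)

Lemma malgUZ (R : nzRingType) (M : choiceType) (c : R) (m : M) :
  << c *g m >> = c *: << m >> :> {malg R[M]}.
Proof. by apply/malgP=> k; rewrite mcoeffZ !mcoeffU mulr_natr. Qed.

Lemma malgUM (R : nzRingType) (M : monomType) (m n : M) :
  << mmul m n >> = << m >> * << n >> :> {malg R[M]}.
Proof. by rewrite malgME !msuppU1 !big_seq_fset1 !mcoeffUU mulr1. Qed.

Lemma free_alg_generated (K : fieldType) (n : nat) (P : free_alg K n -> Prop) :
  subring P -> (forall c : K, P (c *: 1)) -> (forall i, P (free_gen K i)) ->
  forall a, P a.
Proof.
move=> ringP PK Pgen a; rewrite [a]monalgE.
apply: (big_ind P); [exact: subring0 | exact: subringD |] => w _.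
rewrite malgUZ -[<< w >>]mul1r scalerAl.
apply: (subringM ringP) => //; case: w => /=.
elim=> [|i s IHs]; first by rewrite -fmoneE; apply: (subring1 ringP).
have -> : FMonom (i :: s) = mmul (fmu i) (FMonom s).
  by apply/eqP; rewrite fmP fmM fmU.
by rewrite malgUM; apply: (subringM ringP (Pgen i) IHs).
Qed.

(** Two additive operators X and Y make V a module over the free algebra, and
    over the super Jordan plane if they satisfy its relations.  Scalars act
    through iota, so that V may be a module over a larger ring over which X and
    Y are not linear: Y will involve a derivation of K[z]. *)
Section FreeAction.
Variables (K : fieldType) (S : nzRingType) (V : lmodType S).
Variables (iota : {rmorphism K -> S}) (X Y : V -> V).
Hypotheses (XD : {morph X : u v / u + v}) (YD : {morph Y : u v / u + v}).
Hypothesis XZ : forall c v, X (iota c *: v) = iota c *: X v.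
Hypothesis YZ : forall c v, Y (iota c *: v) = iota c *: Y v.

Definition word_act (w : seq 'I_2) (v : V) : V :=
  foldr (fun i v => if i == ord0 then X v else Y v) v w.

Lemma word_actD w : {morph word_act w : u v / u + v}.
Proof. by elim: w => [|i w IHw] u v //=; rewrite IHw XD YD; case: ifP. Qed.

Lemma word_actZ w c v : word_act w (iota c *: v) = iota c *: word_act w v.
Proof. by elim: w => [|i w IHw] //=; rewrite IHw XZ YZ; case: ifP. Qed.

Lemma word_act0 w : word_act w 0 = 0.
Proof. by apply: (addrI (word_act w 0)); rewrite -word_actD !addr0. Qed.

Definition free_act (a : free_alg K 2) (v : V) : V :=
  \sum_(w <- msupp a) iota a@_w *: word_act w v.

Lemma free_actEw (d : {fset {fmonom 'I_2}}) (a : free_alg K 2) v :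
  (msupp a `<=` d)%fset ->
  free_act a v = \sum_(w <- d) iota a@_w *: word_act w v.
Proof.
move=> le; rewrite [LHS](big_fset_incl _ le) // => w _ /mcoeff_outdom ->.
by rewrite rmorph0 scale0r.
Qed.

Lemma free_actDl a b v : free_act (a + b) v = free_act a v + free_act b v.
Proof.
pose d := (msupp a `|` msupp b)%fset.
have sub1 : (msupp a `<=` d)%fset by apply: fsubsetUl.
have sub2 : (msupp b `<=` d)%fset by apply: fsubsetUr.
rewrite (free_actEw _ sub1) (free_actEw _ sub2) (free_actEw _ (msuppD_le a b)).
by rewrite -big_split; apply: eq_bigr => w _; rewrite mcoeffD rmorphD scalerDl.
Qed.

Lemma free_act0 v : free_act 0 v = 0.
Proof. by rewrite /free_act msupp0 big_seq_fset0. Qed.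

Lemma free_act_sum (T : Type) (r : seq T) (F : T -> free_alg K 2) v :
  free_act (\sum_(i <- r) F i) v = \sum_(i <- r) free_act (F i) v.
Proof.
exact: (big_morph (free_act^~ v) (fun a b => free_actDl a b v) (free_act0 v)).
Qed.

Lemma free_actU (c : K) (w : {fmonom 'I_2}) v :
  free_act << c *g w >> v = iota c *: word_act w v.
Proof. by rewrite (free_actEw _ msuppU_le) big_seq_fset1 mcoeffUU. Qed.

Lemma free_actDr a u v : free_act a (u + v) = free_act a u + free_act a v.
Proof.
by rewrite -big_split; apply: eq_bigr => w _; rewrite word_actD scalerDr.
Qed.

Lemma free_actM a b v : free_act (a * b) v = free_act a (free_act b v).
Proof.
rewrite {1}malgME free_act_sum; apply: eq_bigr => w1 _.
rewrite free_act_sum {2}/free_act.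
rewrite (big_morph _ (word_actD w1) (word_act0 w1)) scaler_sumr.
apply: eq_bigr => w2 _; rewrite free_actU word_actZ scalerA -rmorphM.
by rewrite fmM /word_act foldr_cat.
Qed.

Lemma free_act1 v : free_act 1 v = v.
Proof. by rewrite free_actU rmorph1 scale1r fm1. Qed.

Lemma free_act_action : ring_action free_act.
Proof.
split; [exact: free_act1 | exact: free_actM | exact: free_actDl |].
exact: free_actDr.
Qed.

Lemma free_act_x v : free_act (free_gen K ord0) v = X v.
Proof. by rewrite free_actU rmorph1 scale1r fmU. Qed.

Lemma free_act_y v : free_act (free_gen K ord_max) v = Y v.
Proof. by rewrite free_actU rmorph1 scale1r fmU. Qed.

Lemma free_act_scalar c v : free_act (c *: 1) v = iota c *: v.
Proof. by rewrite -mul_malgC mulr1 free_actU fm1. Qed.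

Hypothesis XX : forall v, X (X v) = 0.
Hypothesis Y_Z : forall v, let Z u := X (Y u) + Y (X u) in
  Y (Z v) - Z (Y v) - X (Z v) = 0.

Lemma free_act_sjp_ideal a v : a \in @sjp_ideal K -> free_act a v = 0.
Proof.
have actP := free_act_action.
pose I : {pred free_alg K 2} := fun a => `[< forall v, free_act a v = 0 >].
move=> aI; suff : a \in I by move/asboolP.
apply: (@ideal_gen_min _ (sjp_relations K) I) aI.
  split; first split.
  - by apply/asboolP=> u; apply: free_act0.
  - move=> b c /asboolP b0 /asboolP c0; apply/asboolP=> u.
    by rewrite free_actDl (actionNl actP) b0 c0 subr0.
  - move=> b c /asboolP c0; apply/asboolP=> u.
    by rewrite free_actM c0 (action0r actP).
  - by move=> b c /asboolP c0; apply/asboolP=> u; rewrite free_actM c0.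
move=> b; rewrite !inE => /orP[] /eqP->; apply/asboolP=> u.
  by rewrite free_actM !free_act_x XX.
apply: etrans (action_sjp_relation actP u free_act_x free_act_y) _.
exact: Y_Z.
Qed.

Lemma sjp_action : exists2 act : superJordan K -> V -> V, ring_action act &
  [/\ act (sjp_x K) =1 X, act (sjp_y K) =1 Y
    & forall c v, act (c *: 1) v = iota c *: v].
Proof.
pose act (u : superJordan K) v := free_act (repr u) v.
have actE a v : act (quot_pi (@sjp_ideal K) a) v = free_act a v.
  apply/subr0_eq; rewrite -(actionNl free_act_action) -free_actDl.
  apply: free_act_sjp_ideal; apply/quot_piP; exact: reprK.
exists act.
  split.
  - by move=> v; rewrite -(rmorph1 (quot_pi (@sjp_ideal K))) actE free_act1.
  - elim/quot_piW=> a; elim/quot_piW=> b v.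
    by rewrite -rmorphM !actE free_actM.
  - elim/quot_piW=> a; elim/quot_piW=> b v.
    by rewrite -rmorphD !actE free_actDl.
  - by elim/quot_piW=> a u v; rewrite !actE free_actDr.
split=> [v|v|c v]; first by rewrite actE free_act_x.
  by rewrite actE free_act_y.
have -> : c *: 1 = quot_pi (@sjp_ideal K) (c *: 1) :> superJordan K.
  rewrite (quot_pi_is_scalable (@sjp_ideal K)).
  by rewrite (rmorph1 (quot_pi (@sjp_ideal K))).
by rewrite actE free_act_scalar.
Qed.
End FreeAction.

Definition alg_generated (K : fieldType) (R : algType K) (x y : R) : Prop :=
  forall P : R -> Prop,
    subring P -> (forall c : K, P (c *: 1)) -> P x -> P y -> forall r, P r.

Lemma sjp_generated (K : fieldType) : alg_generated (sjp_x K) (sjp_y K).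
Proof.
move=> P ringP PK Px Py; elim/quot_piW.
pose pi (a : free_alg K 2) : superJordan K := quot_pi (@sjp_ideal K) a.
have piB a b : pi (a - b) = pi a - pi b.
  by apply: (rmorphB (quot_pi (@sjp_ideal K))).
have piM a b : pi (a * b) = pi a * pi b.
  by apply: (rmorphM (quot_pi (@sjp_ideal K))).
apply: (@free_alg_generated K 2 (fun a => P (pi a))).
- split=> [|a b Pa Pb|a b Pa Pb].
  + exact: (subring1 ringP).
  + by rewrite piB; apply: subringB.
  + by rewrite piM; apply: subringM.
- by move=> c; rewrite /pi (quot_pi_is_scalable (@sjp_ideal K)); apply: PK.
move=> i; have [->|->] // : i = ord0 \/ i = ord_max.
by case: i => [[|[|//]] ?]; [left|right]; apply: val_inj.
Qed.

(** * Commutation rules *)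

Section Relations.
Variables (R : nzRingType) (x y z : R).
Hypotheses (xx : x * x = 0) (zE : z = x * y + y * x).
Hypothesis yz_rel : y * z - z * y - x * z = 0.

Lemma sjp_rel_zx : z * x = x * z.
Proof.
rewrite zE mulrDl mulrDr -mulrA [x * (x * y)]mulrA xx mul0r.
by rewrite -[y * x * x]mulrA xx mulr0 addrC mulrA.
Qed.

Lemma sjp_rel_yx : y * x = z - x * y.
Proof. by rewrite zE addrC addKr. Qed.

Lemma sjp_rel_yz : y * z = z * y + x * z.
Proof. by apply/eqP; rewrite -subr_eq0 opprD addrA yz_rel. Qed.
End Relations.

(** * Left Noetherianity *)

Section Noetherian.
Variables (K : fieldType) (R : algType K) (x y z : R).
Hypotheses (xx : x * x = 0) (zE : z = x * y + y * x).
Hypothesis yz_rel : y * z - z * y - x * z = 0.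
Hypothesis generated : alg_generated x y.

Let scalar (r : R) : Prop := exists c : K, r = c *: 1.

Let scalarC a r : scalar a -> a * r = r * a.
Proof. by move=> [c ->]; rewrite -scalerAl mul1r -scalerAr mulr1. Qed.

(** The tower K, K[x], K[x, z], R of extensions of Ore type; y is adjoined with
    twist x |-> -x, z |-> z and derivation x |-> z, z |-> xz. *)
Lemma sjp_algebra_noetherian : noetherian_subring (fun _ : R => True).
Proof.
have ring0 : subring scalar.
  split; first by exists 1; rewrite scale1r.
    by move=> _ _ [c ->] [d ->]; exists (c - d); rewrite scalerBl.
  by move=> _ _ [c ->] [d ->]; exists (c * d); rewrite -scalerAl mul1r scalerA.
have noeth0 : noetherian_subring scalar.
  apply: division_noetherian => _ [c ->] c0.
  exists (c^-1 *: 1); first by exists c^-1.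
  rewrite -scalerAl mul1r scalerA mulVf ?scale1r //.
  by apply/eqP=> c00; apply: c0; rewrite c00 scale0r.
have compat0 a : scalar a -> ore_compatible scalar x a.
  by move=> Aa; apply: ore_compatible_comm => //; apply: scalarC.
pose A1 := ore_ext scalar x.
have ring1 : subring A1 := ore_ext_subring ring0 compat0.
have noeth1 : noetherian_subring A1 := ore_ext_noetherian ring0 compat0 noeth0.
have zx : z * x = x * z := sjp_rel_zx xx zE.
have compat1 a : A1 a -> ore_compatible A1 z a.
  move=> A1a; apply: ore_compatible_comm => //; move: a A1a.
  apply: ore_ext_ind => [||//]; last by move=> a /scalarC.
  split=> [|a b az bz|a b az bz]; first by rewrite mul1r mulr1.
    by rewrite mulrBl mulrBr az bz.
  by rewrite -mulrA bz mulrA az mulrA.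
pose A2 := ore_ext A1 z.
have ring2 : subring A2 := ore_ext_subring ring1 compat1.
have noeth2 : noetherian_subring A2 := ore_ext_noetherian ring1 compat1 noeth1.
have A2_base a : A1 a -> A2 a by apply: ore_ext_base.
have A2x : A2 x by apply/A2_base/ore_ext_gen.
have A2z : A2 z by apply: ore_ext_gen.
have compat2 a : A2 a -> ore_compatible A2 y a.
  have ringP := ore_compatible_subring y ring2.
  move: a; apply: ore_ext_ind => //.
    apply: ore_ext_ind => // [a Aa|].
      apply: ore_compatible_comm => //; last exact: scalarC.
      by apply/A2_base/ore_ext_base.
    split=> //; exists (- x); try exact: subringN.
      by rewrite mulrN opprK -zE.
    by rewrite mulNr -opprD -zE; apply: subringN.
  have yz : y * z = z * y + x * z := sjp_rel_yz yz_rel.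
  have A2zy : A2 (z * y - y * z).
    by rewrite yz opprD addNKr; apply: subringN => //; apply: subringM.
  by split=> //; exists z.
have ring3 := ore_ext_subring ring2 compat2.
have whole r : ore_ext A2 y r.
  apply: generated ring3 _ _ _ r => [c||]; last exact: ore_ext_gen.
    by do 3!apply: ore_ext_base => //; exists c.
  exact: ore_ext_base.
have noeth3 := ore_ext_noetherian ring2 compat2 noeth2.
move=> I subI _; apply: noeth3 => // n; split.
- exact: left_submod0 (subI n).
- exact: left_submodB (subI n).
by move=> a u _; apply: (left_submodM (subI n)).
Qed.
End Noetherian.

Lemma sjp_left_noetherian (K : fieldType) : left_noetherian (superJordan K).
Proof.
move=> I subI Ihomo.
have xx : sjp_x K * sjp_x K = 0 by exact: sjp_x2.
have noeth := sjp_algebra_noetherian xx erefl (sjp_yz K) (@sjp_generated K).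
have [n|//|n u|N stable] := noeth (fun n r => r \in I n); last 2 first.
- exact: Ihomo.
- exists N => n le_Nn u; apply/idP/idP; first exact: stable.
  exact: (chain_homo (I := fun n r => r \in I n)) le_Nn u.
have [I0 I_lin] := subI n; split=> // [u v Iu Iv|a u _ Iu].
  by rewrite addrC -[- v]mulN1r; apply: (I_lin (-1) v u).
by rewrite -[a * u]addr0; apply: (I_lin a u 0 Iu I0).
Qed.

(** * The normally ordered model *)

(** A pair (f, g) of polynomials in y over K[z] stands for f + xg, with x to the
    left of z and z to the left of y.  The operators pbw_x and pbw_y are left
    multiplication by x and y in this normal form. *)
Section PolynomialModule.
Variable K : fieldType.
Local Notation P := {poly {poly K}}.

(** The operator z d/dz on polynomials in y and z; it measures the failure of
    y to commute with z, as yf = fy + x (z df/dz) for f in K[z]. *)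
Definition euler (f : P) : P := map_poly (fun p => 'X * p^`()) f.

Let D0 : 'X * (0 : {poly K})^`() = 0. Proof. by rewrite deriv0 mulr0. Qed.

Lemma coef_euler f i : (euler f)`_i = 'X * (f`_i)^`().
Proof. by rewrite coef_map_id0. Qed.

Lemma euler0 : euler 0 = 0.
Proof. by apply/polyP=> i; rewrite coef_euler !coef0 D0. Qed.

Lemma eulerD : {morph euler : f g / f + g}.
Proof.
by move=> f g; apply/polyP=> i; rewrite !(coef_euler, coefD) derivD mulrDr.
Qed.

Lemma eulerZ (c : K) f : euler (c%:P *: f) = c%:P *: euler f.
Proof.
apply/polyP=> i; rewrite !(coef_euler, coefZ) derivM derivC mul0r add0r.
by rewrite mulrCA.
Qed.

Lemma eulerMX f : euler (f * 'X) = euler f * 'X.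
Proof. by apply/polyP=> [[|i]]; rewrite !(coef_euler, coefMX) /= ?D0. Qed.

Lemma eulerC p : euler p%:P = ('X * p^`())%:P.
Proof.
by apply/polyP=> i; rewrite coef_euler !coefC; case: eqP; rewrite ?D0.
Qed.

Lemma euler_scaleX f : euler ('X *: f) = 'X *: f + 'X *: euler f.
Proof.
apply/polyP=> i; rewrite coefD !(coef_euler, coefZ) derivM derivX mul1r.
by rewrite mulrDr.
Qed.

Definition pbw_x (v : P * P) : P * P := (0, v.1).
Definition pbw_y (v : P * P) : P * P :=
  ('X * v.1 + 'X *: v.2, euler v.1 - 'X * v.2).

Lemma pbw_xD : {morph pbw_x : u v / u + v}.
Proof. by move=> u v; rewrite /pbw_x; congr (_, _); rewrite /= addr0. Qed.

Lemma pbw_yD : {morph pbw_y : u v / u + v}.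
Proof.
move=> [u1 u2] [v1 v2]; rewrite /pbw_y /=; congr (_, _) => /=.
  by rewrite mulrDr scalerDr addrACA.
by rewrite eulerD mulrDr opprD addrACA.
Qed.

Lemma pbw_xZ (c : K) v : pbw_x (c%:P *: v) = c%:P *: pbw_x v.
Proof. by congr (_, _); rewrite /= scaler0. Qed.

Lemma pbw_yZ (c : K) v : pbw_y (c%:P *: v) = c%:P *: pbw_y v.
Proof.
case: v => v1 v2; congr (_, _) => /=.
  by rewrite scalerDr -scalerAr !scalerA [c%:P * 'X]mulrC.
by rewrite eulerZ scalerBr -scalerAr.
Qed.

Lemma pbw_xx v : pbw_x (pbw_x v) = 0.
Proof. by []. Qed.

Lemma pbw_z v : pbw_x (pbw_y v) + pbw_y (pbw_x v) = 'X *: v.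
Proof.
case: v => v1 v2; congr (_, _) => /=; first by rewrite mulr0 !add0r.
by rewrite euler0 add0r addrAC subrr add0r.
Qed.

Lemma pbw_yz v : let Z u := pbw_x (pbw_y u) + pbw_y (pbw_x u) in
  pbw_y (Z v) - Z (pbw_y v) - pbw_x (Z v) = 0.
Proof.
rewrite /= !pbw_z; case: v => v1 v2; congr (_, _) => /=.
  by rewrite scalerDr !scalerA scalerAr subrr subr0.
rewrite euler_scaleX scalerBr scalerAr.
by rewrite opprB addrA subrK addrK subrr.
Qed.
End PolynomialModule.

Section NormalForm.
Variables (K : fieldType) (R : algType K) (x y z : R).
Hypotheses (xx : x * x = 0) (zE : z = x * y + y * x).
Hypothesis yz_rel : y * z - z * y - x * z = 0.
Local Notation P := {poly {poly K}}.

Let zx : z * x = x * z := sjp_rel_zx xx zE.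
Let yx : y * x = z - x * y := sjp_rel_yx zE.
Let yz : y * z = z * y + x * z := sjp_rel_yz yz_rel.

Definition zeval : {poly K} -> R := horner_alg z.

HB.instance Definition _ := GRing.RMorphism.on zeval.

Lemma zevalC c : zeval c%:P = c%:A. Proof. exact: horner_algC. Qed.
Lemma zevalX : zeval 'X = z. Proof. exact: horner_algX. Qed.

Lemma zevalMX p : zeval (p * 'X) = zeval p * z.
Proof. by rewrite rmorphM /= zevalX. Qed.

Lemma poly_linear_ind (Q : {poly K} -> Prop) :
  (forall c, Q c%:P) -> (forall p q, Q p -> Q q -> Q (p + q)) ->
  (forall p, Q p -> Q (p * 'X)) -> forall p, Q p.
Proof.
move=> QC QD QX; apply: poly_ind => [|p c Qp]; first by rewrite -polyC0.
by apply: QD => //; apply: QX.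
Qed.

Lemma zeval_x p : zeval p * x = x * zeval p.
Proof.
elim/poly_linear_ind: p => [c|p q IHp IHq|p IHp].
- by rewrite zevalC -scalerAl mul1r -scalerAr mulr1.
- by rewrite rmorphD mulrDl mulrDr IHp IHq.
by rewrite rmorphM /= zevalX -mulrA zx mulrA IHp mulrA.
Qed.

Lemma y_zeval p : y * zeval p = zeval p * y + x * zeval ('X * p^`()).
Proof.
elim/poly_linear_ind: p => [c|p q IHp IHq|p IHp].
- rewrite zevalC derivC mulr0 rmorph0 mulr0 addr0.
  by rewrite -scalerAl mul1r -scalerAr mulr1.
- by rewrite derivD mulrDr !rmorphD !mulrDr mulrDl IHp IHq addrACA.
have -> : 'X * (p * 'X)^`() = 'X * p^`() * 'X + p * 'X.
  by rewrite derivM derivX mulr1 mulrDr mulrA (mulrC 'X p).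
rewrite rmorphD /= !zevalMX.
rewrite mulrA IHp mulrDl -[zeval p * y * z]mulrA yz mulrDr.
by rewrite !mulrDr !mulrA zeval_x -!addrA; congr (_ + _); rewrite addrC.
Qed.

(** Evaluation over a non-commutative ring puts the coefficients, here
    polynomials in z, to the left of the powers of y. *)
Definition zy_eval (f : P) : R := (map_poly zeval f).[y].

Lemma zy_eval0 : zy_eval 0 = 0.
Proof. by rewrite /zy_eval rmorph0 horner0. Qed.

Lemma zy_evalD : {morph zy_eval : f g / f + g}.
Proof. by move=> f g; rewrite /zy_eval rmorphD hornerD. Qed.

Lemma zy_evalN f : zy_eval (- f) = - zy_eval f.
Proof. by rewrite /zy_eval rmorphN hornerN. Qed.

Lemma zy_evalMX f : zy_eval (f * 'X) = zy_eval f * y.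
Proof. by rewrite /zy_eval rmorphM /= map_polyX hornerMX. Qed.

Lemma zy_evalZ p f : zy_eval (p *: f) = zeval p * zy_eval f.
Proof. by rewrite /zy_eval -mul_polyC rmorphM /= map_polyC hornerCM. Qed.

Lemma zy_evalC p : zy_eval p%:P = zeval p.
Proof. by rewrite /zy_eval map_polyC hornerC. Qed.

Lemma y_zy_eval f : y * zy_eval f = zy_eval ('X * f) + x * zy_eval (euler f).
Proof.
elim/poly_ind: f => [|f p IHf].
  by rewrite euler0 mulr0 zy_eval0 !mulr0 addr0.
rewrite eulerD mulrDr !zy_evalD !mulrDr eulerMX [in RHS]mulrA ['X * p%:P]mulrC.
rewrite !zy_evalMX eulerC !zy_evalC y_zeval !mulrA IHf mulrDl.
by rewrite addrACA.
Qed.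

Definition pbw_eval (v : P * P) : R := zy_eval v.1 + x * zy_eval v.2.

Lemma pbw_eval_x v : pbw_eval (pbw_x v) = x * pbw_eval v.
Proof. by rewrite /pbw_eval /= mulrDr mulrA xx mul0r addr0 zy_eval0 add0r. Qed.

Lemma pbw_eval_y v : pbw_eval (pbw_y v) = y * pbw_eval v.
Proof.
rewrite /pbw_eval /= !zy_evalD zy_evalN zy_evalZ zevalX.
rewrite [RHS]mulrDr [y * (x * _)]mulrA yx mulrBl -(mulrA x y) !y_zy_eval.
by rewrite !mulrDr mulrN (mulrA x x) xx mul0r addr0 addrACA.
Qed.

Lemma pbw_evalD : {morph pbw_eval : u v / u + v}.
Proof. by move=> u v; rewrite /pbw_eval !zy_evalD mulrDr addrACA. Qed.

Lemma pbw_evalZ (c : K) v : pbw_eval (c%:P *: v) = c *: pbw_eval v.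
Proof.
by rewrite /pbw_eval !zy_evalZ zevalC -!scalerAl !mul1r scalerDr -scalerAr.
Qed.

Hypothesis generated : alg_generated x y.
Variable act : R -> P * P -> P * P.
Hypotheses (actP : ring_action act)
  (act_x : act x =1 @pbw_x K) (act_y : act y =1 @pbw_y K)
  (act_scalar : forall c v, act (c *: 1) v = c%:P *: v).

Lemma pbw_eval_act b v : pbw_eval (act b v) = b * pbw_eval v.
Proof.
move: b v; apply: generated => [|c v|v|v].
- split=> [v|a b aP bP v|a b aP bP v].
  + by rewrite (action1 actP) mul1r.
  + rewrite (actionDl actP) pbw_evalD // aP mulrBl; congr (_ + _).
    apply: (addrI (b * pbw_eval v)); rewrite -bP subrr -pbw_evalD.
    rewrite -(actionDl actP) subrr (action0l actP) /pbw_eval.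
    by rewrite zy_eval0 mulr0 addr0.
  + by rewrite (actionM actP) aP bP mulrA.
- by rewrite act_scalar pbw_evalZ -scalerAl mul1r.
- by rewrite act_x pbw_eval_x.
by rewrite act_y pbw_eval_y.
Qed.

(** Writing b as the evaluation f + xg of the pair b(1, 0) = (f, g), the pair
    xb(1, 0) is (0, f); so xb = 0 gives f = 0 and b = xg. *)
Lemma pbw_mulx_exact b : x * b = 0 -> exists c, b = x * c.
Proof.
move=> xb0; have eval1 : pbw_eval (1, 0) = 1.
  by rewrite /pbw_eval /= zy_evalC rmorph1 zy_eval0 mulr0 addr0.
have := pbw_eval_act b (1, 0); rewrite eval1 mulr1 => <-.
have := congr1 (fun r => (act r (1, 0)).2) xb0.
rewrite /= (actionM actP) act_x (action0l actP) /= => f0.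
exists (zy_eval (act b (1, 0)).2).
by rewrite /pbw_eval f0 zy_eval0 add0r.
Qed.
End NormalForm.

Lemma sjp_mulx_exact (K : fieldType) (b : superJordan K) :
  sjp_x K * b = 0 -> exists c, b = sjp_x K * c.
Proof.
have [act actP [act_x act_y act_scalar]] := sjp_action (iota := @polyC K)
  (@pbw_xD K) (@pbw_yD K) (@pbw_xZ K) (@pbw_yZ K) (@pbw_xx K) (@pbw_yz K).
have xx : sjp_x K * sjp_x K = 0 by exact: sjp_x2.
exact: (pbw_mulx_exact xx erefl (sjp_yz K) (@sjp_generated K)
          actP act_x act_y act_scalar).
Qed.

(** * The anti-automorphism *)

Definition anti_involution (R : nzRingType) (al : R -> R) : Prop :=
  [/\ al 1 = 1, {morph al : a b / a + b}, forall a b, al (a * b) = al b * al a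
    & involutive al].

Lemma anti_involution0 (R : nzRingType) (al : R -> R) :
  anti_involution al -> al 0 = 0.
Proof. by case=> _ alD _ _; apply: (addrI (al 0)); rewrite -alD !addr0. Qed.

Lemma anti_involution_noetherian (R : nzRingType) (al : R -> R) :
  anti_involution al -> left_noetherian R -> left_noetherian R^c.
Proof.
move=> [al1 alD alM alK] noethR I subI Ihomo.
have al0 := anti_involution0 (And4 al1 alD alM alK).
pose J n : {pred R^o} := fun r => al r \in I n.
have [n|n r|N stable] := noethR J; [split| |].
- by rewrite /J unfold_in al0; case: (subI n).
- move=> a u v; rewrite !unfold_in => Iu Iv; have [_] := subI n.
  by move/(_ (al a) _ _ Iu Iv); rewrite alD alM.
- by rewrite !unfold_in; apply: Ihomo.
exists N => n le_Nn r; have := stable n le_Nn (al r).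
by rewrite !unfold_in alK.
Qed.

(** Right multiplication by -x and y again satisfies the defining relations:
    the sign of x absorbs the reversal of the order of multiplication. *)
Section RightMultiplication.
Variables (K : fieldType) (R : algType K) (x y z : R).
Hypotheses (xx : x * x = 0) (zE : z = x * y + y * x).
Hypothesis yz_rel : y * z - z * y - x * z = 0.

Definition rmulNx (u : R) : R := - (u * x).
Definition rmuly (u : R) : R := u * y.

Lemma rmulNxD : {morph rmulNx : u v / u + v}.
Proof. by move=> u v; rewrite /rmulNx mulrDl opprD. Qed.

Lemma rmulyD : {morph rmuly : u v / u + v}.
Proof. by move=> u v; rewrite /rmuly mulrDl. Qed.

Lemma rmulNxZ (c : K) u : rmulNx (c *: u) = c *: rmulNx u.
Proof. by rewrite /rmulNx -scalerAl scalerN. Qed.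

Lemma rmulyZ (c : K) u : rmuly (c *: u) = c *: rmuly u.
Proof. by rewrite /rmuly -scalerAl. Qed.

Lemma rmulNx_sqr u : rmulNx (rmulNx u) = 0.
Proof. by rewrite /rmulNx mulNr opprK -mulrA xx mulr0. Qed.

Lemma rmul_yz u : let Z v := rmulNx (rmuly v) + rmuly (rmulNx v) in
  rmuly (Z u) - Z (rmuly u) - rmulNx (Z u) = 0.
Proof.
have ZE v : rmulNx (rmuly v) + rmuly (rmulNx v) = - (v * z).
  by rewrite /rmulNx /rmuly zE mulNr -opprD mulrDr !mulrA addrC.
rewrite /= !ZE /rmulNx /rmuly !mulNr !opprK -!mulrA.
by rewrite (sjp_rel_zx xx zE) (sjp_rel_yz yz_rel) mulrDr addKr subrr.
Qed.
End RightMultiplication.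

(** The algebra acts on itself on the left with x and y acting as right
    multiplication by -x and y; then a |-> a . 1 is the anti-automorphism. *)
Lemma sjp_anti_involution (K : fieldType) :
  exists2 al : superJordan K -> superJordan K,
    anti_involution al & al (sjp_x K) = - sjp_x K.
Proof.
have xx : sjp_x K * sjp_x K = 0 by exact: sjp_x2.
have [act actP [act_x act_y act_scalar]] :=
  sjp_action (V := superJordan K) (iota := idfun)
    (rmulNxD (sjp_x K)) (rmulyD (sjp_y K))
    (@rmulNxZ K (superJordan K) (sjp_x K)) (@rmulyZ K (superJordan K) (sjp_y K))
    (rmulNx_sqr xx) (rmul_yz xx erefl (sjp_yz K)).
have act_mul a v : act a v = v * act a 1.
  move: a v; apply: sjp_generated => [|c v|v|v].
  - split=> [v|a b aP bP v|a b aP bP v].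
    + by rewrite !(action1 actP) mulr1.
    + by rewrite !(actionDl actP, actionNl actP) aP bP mulrBr.
    + by rewrite !(actionM actP) aP bP [act a (act b 1)]aP mulrA.
  - by rewrite !act_scalar -scalerAr mulr1.
  - by rewrite !act_x /rmulNx mul1r mulrN.
  - by rewrite !act_y /rmuly mul1r.
have alM a b : act (a * b) 1 = act b 1 * act a 1.
  by rewrite (actionM actP) act_mul.
have alB a b : act (a - b) 1 = act a 1 - act b 1.
  by rewrite (actionDl actP) (actionNl actP).
exists (fun a => act a 1); last by rewrite act_x /rmulNx mul1r.
split=> //; [exact: action1 | by move=> a b; exact: actionDl |].
apply: sjp_generated => [|c||].
- split=> [|a b aP bP|a b aP bP].
  + by rewrite !(action1 actP).
  + by rewrite !alB aP bP.
  + by rewrite !alM aP bP.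
- by rewrite !act_scalar.
- rewrite act_x /rmulNx mul1r (actionNl actP) act_x /rmulNx mul1r.
  by rewrite opprK.
by rewrite act_y /rmuly mul1r act_y /rmuly mul1r.
Qed.

(** * The super Jordan plane is Noetherian of infinite global dimension *)

Lemma sjp_trivial_action (K : fieldType) :
  exists2 act : superJordan K -> K -> K,
    ring_action act & forall c, act (sjp_x K) c = 0.
Proof.
have [act actP [act_x _ _]] := sjp_action (V := K^o) (iota := idfun)
  (X := fun=> 0) (Y := fun=> 0)
  ltac:(by move=> u v; rewrite addr0) ltac:(by move=> u v; rewrite addr0)
  ltac:(by move=> c v; rewrite scaler0) ltac:(by move=> c v; rewrite scaler0)
  ltac:(by []) ltac:(by move=> v /=; rewrite addr0 !subr0).
by exists act.
Qed.

Theorem corollary1p4 (K : fieldType) (charK : 2%N \notin [pchar K]) :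
  noetherian (superJordan K) /\ infinite_gldim (superJordan K).
Proof.
have [al al_anti al_x] := sjp_anti_involution K.
have [act actP act_x] := sjp_trivial_action K.
have xx : sjp_x K * sjp_x K = 0 by exact: sjp_x2.
have one0 : (1 : K) <> 0 by apply/eqP; apply: oner_neq0.
split; split.
- exact: sjp_left_noetherian.
- exact: anti_involution_noetherian al_anti (@sjp_left_noetherian K).
- apply: infinite_left_gldim_of_action xx _ actP act_x one0.
  exact: sjp_mulx_exact.
have [al1 alD alM alK] := al_anti; have al0 := anti_involution0 al_anti.
pose act' (a : (superJordan K)^c) := act (al a).
apply: (@infinite_left_gldim_of_action (superJordan K)^c (sjp_x K) K act' 1)
  => // [b bx0||c].
- (* In the converse ring bx0 reads b x = 0, so that x kills al b. *)
  have bx : (b : superJordan K) * sjp_x K = 0 := bx0.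
  have [|c alb] := @sjp_mulx_exact K (al b).
    by rewrite -[sjp_x K]opprK -al_x mulNr -alM bx al0 oppr0.
  by exists (- al c); rewrite -[b]alK alb alM al_x mulrN -mulNr.
- split=> [v|a b v|a b v|a u v]; rewrite /act'.
  + by rewrite [al 1]al1 (action1 actP).
  + by rewrite [al (a * b)]alM (actionM actP).
  + by rewrite alD (actionDl actP).
  + by rewrite (actionDr actP).
by rewrite /act' al_x (actionNl actP) act_x oppr0.
Qed.
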